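(* Let $\sigma\in(0,1)$ be any fixed constant. Then for every $\lambda\in(\lambda_\sigma,\frac12)$: (1) there is no positive $C^2$ solution $y:\mathbb{R}\to(0,+\infty)$ of the ODE $$(y'')^{+}-\sigma^{2}(y'')^{-}+xy'+2\lambda y=0;$$ (2) there is no positive solution $u$ of the $G$-heat equation $\partial_tu-G(\partial_{xx}^2u)=0$ on $[0,+\infty)\times\mathbb{R}$ with initial condition $u(0,x)=H(x)$ that is of the form $$u(t,x)=(1+t)^{-\lambda}H\!\left(\frac{x}{\sqrt{1+t}}\right).$$
   Context: For real $a$, $a^{+}=\max\{0,a\}$ and $a^{-}=(-a)^{+}$; $G(a)=\frac12(a^{+}-\sigma^{2}a^{-})$. Solutions of the $G$-heat equation are understood in the viscosity sense; since the equation is uniformly parabolic and $G$ is convex, it is a known fact that solutions are of class $C^{1,2}$. For $\lambda\in(0,\frac12)$ and $x\in\mathbb{R}$, $$\varphi_\lambda(x):=\int_0^{+\infty}y^{-2\lambda}\exp\left\{-\frac{(y-x)^2}{2}\right\}dy ,$$ and primes denote derivatives in $x$. For each $\lambda\in(0,\frac12)$, $x_1^\lambda<0$ denotes the unique negative number with $\varphi_\lambda''(x_1^\lambda)=0$, $z^\lambda>0$ denotes the unique positive number with $\varphi_\lambda''(z^\lambda)+\varphi_\lambda''(-z^\lambda)=0$ (existence and uniqueness hold), and $\sigma_\lambda:=-x_1^\lambda/z^\lambda\in(0,1)$. The map $\lambda\mapsto\sigma_\lambda$ is a continuous strictly increasing bijection from $(0,\frac12)$ onto $(0,1)$; for $\sigma\in(0,1)$,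 $\lambda_\sigma\in(0,\frac12)$ denotes the unique constant with $\sigma_{\lambda_\sigma}=\sigma$. *)

(* Defs.v *)
From HB Require Import structures.
From mathcomp Require Import all_boot all_order all_algebra.
From mathcomp Require Import all_classical all_reals all_analysis.
Set Implicit Arguments.
Unset Strict Implicit.
Unset Printing Implicit Defensive.
Import Order.TTheory GRing.Theory Num.Theory.
Import numFieldNormedType.Exports.
Local Open Scope ring_scope.
Local Open Scope classical_set_scope.

Definition pos_part (R : realType) (a : R) : R := Num.max 0 a.
Definition neg_part (R : realType) (a : R) : R := pos_part (- a).

Definition G (R : realType) (sigma a : R) : R :=
  2^-1 * (pos_part a - sigma ^+ 2 * neg_part a).

Definition phi (R : realType) (lam x : R) : R :=
  \int[@lebesgue_measure R]_(y in `]0, +oo[)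
    (y `^ (- (2 * lam)) * expR (- ((y - x) ^+ 2 / 2))).

(* For lam in ]0, 1/2[ the two sets below are singletons, so [xget] returns
   their only element. The default value 0 belongs to neither set. *)
Definition x1 (R : realType) (lam : R) : R :=
  xget 0 [set x : R | x < 0 /\ derive1n 2 (phi lam) x = 0].

Definition z (R : realType) (lam : R) : R :=
  xget 0 [set x : R | 0 < x /\ derive1n 2 (phi lam) x + derive1n 2 (phi lam) (- x) = 0].

Definition sigma_of (R : realType) (lam : R) : R := - x1 lam / z lam.

Definition C2 (R : realType) (y : R -> R) : Prop :=
  [/\ forall x, derivable y x 1,
      forall x, derivable (derive1 y) x 1
    & continuous (derive1n 2 y)].

(* C^{1,2} on the open half-plane ]0, +oo[ x R. *)
Definition C12 (R : realType) (psi : R -> R -> R) : Prop :=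
  forall t x : R, 0 < t ->
  [/\ derivable (fun s => psi s x) t 1,
      derivable (psi t) x 1
    & derivable (derive1 (psi t)) x 1] /\
  [/\ {for (t, x), continuous (fun p : R * R => psi p.1 p.2)},
      {for (t, x), continuous
         (fun p : R * R => derive1 (fun s => psi s p.2) p.1)},
      {for (t, x), continuous (fun p : R * R => derive1 (psi p.1) p.2)}
    & {for (t, x), continuous (fun p : R * R => derive1n 2 (psi p.1) p.2)}].

Definition G_heat_subsolution (R : realType) (sigma : R) (u : R -> R -> R) :
    Prop :=
  forall psi : R -> R -> R, C12 psi -> forall t x : R, 0 < t ->
  (\forall p \near (t, x),
     u p.1 p.2 - psi p.1 p.2 <= u t x - psi t x) ->
  derive1 (fun s => psi s x) t - G sigma (derive1n 2 (psi t) x) <= 0.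

Definition G_heat_supersolution (R : realType) (sigma : R) (u : R -> R -> R) :
    Prop :=
  forall psi : R -> R -> R, C12 psi -> forall t x : R, 0 < t ->
  (\forall p \near (t, x),
     u t x - psi t x <= u p.1 p.2 - psi p.1 p.2) ->
  0 <= derive1 (fun s => psi s x) t - G sigma (derive1n 2 (psi t) x).

(* Viscosity solution on [0, +oo[ x R; the values [u t x] for t < 0 play
   no role. *)
Definition G_heat_solution (R : realType) (sigma : R) (u : R -> R -> R) :
    Prop :=
  [/\ {within [set p : R * R | 0 <= p.1],
         continuous (fun p : R * R => u p.1 p.2)},
      G_heat_subsolution sigma u
    & G_heat_supersolution sigma u].

(* Main.v *)
(** Write [lambda0] for [lambda_sigma], [phi] for [phi lambda0] and
    [c = - x1 lambda0 = sigma * z lambda0].  Since [phi'' + x phi' + 2 lambda0 phi = 0],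
    gluing [phi (x / sigma) + phi (- x / sigma)] on [|x| <= c] to a multiple of
    [phi (- |x|)] on [|x| >= c] yields a positive [C^2] solution of the ODE for
    [lambda0] with Gaussian decay.  For [lambda > lambda0], subtracting
    [e * exp (- x^2 / 4)] with [e] small turns it into a strict subsolution [v] of
    the ODE for [lambda] that is positive only on a bounded set.  If [H > 0] is
    continuous, then [v / H] attains a positive maximum, where a multiple of [v]
    touches [H] from below.  This rules out that [H] solves the ODE, in the classical
    sense for (1) and, through a self-similar test function, in the viscosity sense
    for (2). *)
Require Import Defs.
From HB Require Import structures.
From mathcomp Require Import all_boot all_order all_algebra.
From mathcomp Require Import all_classical all_reals all_analysis.
From mathcomp Require Import measurable_realfun ring lra.
Set Implicit Arguments.
Unset Strict Implicit.
Unset Printing Implicit Defensive.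
Import Order.TTheory GRing.Theory Num.Theory.
Import numFieldNormedType.Exports.
Local Open Scope ring_scope.
Local Open Scope classical_set_scope.

Notation leb := (@lebesgue_measure _).

(** * Improper integrals over the positive half-line *)

(** Dominated convergence for the truncations of [f] to [E n], with [|f|] as dominating function: at
    each point of [D] they eventually equal [f]. *)
Lemma cvg_integral_exhaustion (R : realType) (D : set R) (E : (set R)^nat)
    (f : R -> R) :
  measurable D -> (forall n, measurable (E n)) -> (forall n, E n `<=` D) ->
  (forall x, D x -> \forall n \near \oo, E n x) ->
  leb.-integrable D (EFin \o f) ->
  (\int[leb]_(x in E n) f x) @[n --> \oo] --> \int[leb]_(x in D) f x.
Proof.
move=> mD mE ED En intf.
rewrite /Rintegral; apply: fine_cvg.
rewrite fineK; last exact: integrable_fin_num.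
have -> : (fun n => (\int[leb]_(x in E n) (f x)%:E)%E) =
    (fun n => (\int[leb]_(x in D) ((EFin \o f) \_ (E n)) x)%E).
  apply/funext => n; rewrite -integral_mkcondr.
  by congr integral; rewrite setIC; apply/esym/setIidPl.
have mf := measurable_int _ intf.
apply: (@dominated_cvg _ _ _ leb D mD (fun n => (EFin \o f) \_ (E n))
  (EFin \o f) (abse \o (EFin \o f))) => //.
- move=> n; apply/measurable_restrict => //.
    exact: mE.
  by apply: (measurable_funS mD _ mf); exact: subIsetl.
- move=> x Dx.
  apply: cvg_near_cst; near=> n.
  have Enx : E n x by near: n; exact: En.
  by rewrite /patch mem_set.
- exact: integrable_abse.
- move=> n x Dx; rewrite /patch; case: ifPn => // _.
  by rewrite /= normr0 lee_fin.
Unshelve. all: by end_near. Qed.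

Section ftc_0y.
Variable R : realType.
Implicit Types F f : R -> R.

(** The shift by two makes the interval nondegenerate already for [n = 0], as [continuous_FTC2]
    requires. *)
Let E (n : nat) : set R := `[n.+2%:R^-1, n.+2%:R].

Let E_subset n : E n `<=` `]0, +oo[.
Proof.
move=> x; rewrite /E !set_itvE/= => /andP[h _].
by rewrite (lt_le_trans _ h).
Qed.

Let E_near (x : R) : 0 < x -> \forall n \near \oo, E n x.
Proof.
move=> x0; near=> n; rewrite /E/= in_itv/=; apply/andP; split.
  rewrite invf_ple ?posrE//.
  have /le_trans : x^-1 <= n%:R by near: n; exact: nbhs_infty_ger.
  by apply; rewrite ler_nat; apply/leqW/leqW.
have /le_trans : x <= n%:R by near: n; exact: nbhs_infty_ger.
by apply; rewrite ler_nat; apply/leqW/leqW.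
Unshelve. all: by end_near. Qed.

Let E_lt n : n.+2%:R^-1 < n.+2%:R :> R.
Proof. by rewrite (@lt_trans _ _ 1)// ?invf_lt1// ltr1n. Qed.

Let cvg_E_left : n.+2%:R^-1 @[n --> \oo] --> (0:R).
Proof.
have := @cvg_harmonic R; rewrite -(@cvg_shiftn 1).
by apply: cvg_trans; apply: near_eq_cvg; near=> n; rewrite /harmonic/= addn1.
Unshelve. all: by end_near. Qed.

Let integral_E F f n :
  (forall x : R, 0 < x -> is_derive x 1 F (f x)) ->
  (forall x : R, 0 < x -> {for x, continuous f}) ->
  (\int[leb]_(x in E n) (f x)%:E = (F n.+2%:R)%:E - (F n.+2%:R^-1)%:E)%E.
Proof.
move=> dF cf.
have cF x : 0 < x -> {for x, continuous F}.
  by move=> /dF dFx; apply: differentiable_continuous; apply/derivable1_diffP.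
have E0 : 0 < n.+2%:R^-1 :> R by rewrite invr_gt0.
have in_gt0 x : x \in `]n.+2%:R^-1, n.+2%:R[%R -> 0 < x :> R.
  by rewrite in_itv/= => /andP[+ _]; exact: lt_trans.
apply: continuous_FTC2 (E_lt n) _ _ _.
- apply: continuous_in_subspaceT => x; rewrite inE => /E_subset.
  by rewrite set_itvE; exact: cf.
- split.
  + by move=> x /in_gt0/dF dFx.
  + by apply: cvg_at_right_filter; exact: cF.
  + by apply: cvg_at_left_filter; exact: cF.
- by move=> x /in_gt0/dF dFx; rewrite derive1E derive_val.
Qed.

(** The theorem on each [E n] passes to the limit. At 0 only a limit of [F] is asked, since
    [y^(p + 1)] with [-1 < p < 0] is not differentiable there. *)
Lemma Rintegral_FTC_0y F f (a b : R) :
  (forall x : R, 0 < x -> is_derive x 1 F (f x)) ->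
  (forall x : R, 0 < x -> {for x, continuous f}) ->
  leb.-integrable `]0, +oo[ (EFin \o f) ->
  F x @[x --> 0^'+] --> a -> F x @[x --> +oo%R] --> b ->
  \int[leb]_(x in `]0, +oo[) f x = b - a.
Proof.
move=> dF cf intf Fa Fb.
have /cvg_unique : (\int[leb]_(x in E n) f x) @[n --> \oo] -->
    \int[leb]_(x in `]0, +oo[) f x.
  apply: cvg_integral_exhaustion => //; first by move=> n; exact: measurable_itv.
  by move=> x; rewrite set_itvE; exact: E_near.
apply => //.
have -> : (fun n => \int[leb]_(x in E n) f x) =
    (fun n => F n.+2%:R - F n.+2%:R^-1).
  by apply/funext => n; rewrite /Rintegral (integral_E _ dF cf) -EFinB.
apply: cvgB.
  have /cvg_pinftyP := Fb; apply.
  apply/cvgryPge => r; near=> n.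
  have /le_trans : r <= n%:R by near: n; exact: nbhs_infty_ger.
  by apply; rewrite ler_nat; apply/leqW/leqW.
have /cvg_at_rightP := Fa; by apply; split => // n; rewrite invr_gt0.
Unshelve. all: by end_near. Qed.

(** Monotone convergence along [E n]: the partial integrals are increments of [F], hence at most
    [C]. *)
Lemma ge0_integrable_FTC_0y F f (C : R) :
  (forall x : R, 0 < x -> is_derive x 1 F (f x)) ->
  (forall x : R, 0 < x -> {for x, continuous f}) ->
  (forall x : R, 0 < x -> 0 <= f x) ->
  (forall x y : R, 0 < x -> 0 < y -> F x - F y <= C) ->
  leb.-integrable `]0, +oo[ (EFin \o f).
Proof.
move=> dF cf f0 FC.
set D : set R := `]0, +oo[.
have mf : measurable_fun D f.
  apply: open_continuous_measurable_fun => // x.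
  by rewrite inE /D set_itvE; exact: cf.
apply/integrableP; split; first exact/measurable_EFinP.
apply: (@le_lt_trans _ _ C%:E); last exact: ltry.
have -> : (\int[leb]_(x in D) `|(EFin \o f) x| =
    \int[leb]_(x in \bigcup_n E n) (f x)%:E)%E.
  rewrite (_ : \bigcup_n E n = D); last first.
    apply/seteqP; split; first by move=> x [n _ /E_subset].
    move=> x; rewrite /D set_itvE => /E_near[n _ /(_ n)]/=.
    by move=> /(_ (leqnn _)); exists n.
  apply: eq_integral => x; rewrite inE /D set_itvE => /f0 fx0.
  by rewrite gee0_abs// lee_fin.
have mE n : measurable (E n) by exact: measurable_itv.
have cvgE : (\int[leb]_(x in E n) (f x)%:E)%E @[n --> \oo] -->
    (\int[leb]_(x in \bigcup_n E n) (f x)%:E)%E.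
  apply: ge0_nondecreasing_set_cvg_integral => //.
  - move=> m n mn; rewrite subsetEset; apply: subset_itv; rewrite bnd_simp.
      by rewrite lef_pV2 ?posrE// ler_nat.
    by rewrite ler_nat.
  - move=> n; apply/measurable_EFinP.
    by apply: measurable_funS mf; [exact: measurable_itv|exact: E_subset].
  - by move=> n x /E_subset; rewrite set_itvE lee_fin => /f0.
rewrite -(cvg_lim _ cvgE)//; apply: lime_le; first by apply/cvg_ex; eexists; exact: cvgE.
apply: nearW => n; rewrite (integral_E _ dF cf) -EFinB lee_fin.
by apply: FC => //; rewrite invr_gt0.
Qed.

End ftc_0y.

(** * Moments of a shifted Gaussian on the half-line *)

Section gaussian_moments.
Variable R : realType.
Implicit Types p x y : R.

(** The exponent stays free because differentiation in [x] raises it by one; [phi lam] is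
    convertible to [moment (- (2 * lam))]. *)
Definition moment_integrand p x y : R := y `^ p * expR (- ((y - x) ^+ 2 / 2)).

Definition moment p x : R := \int[leb]_(y in `]0, +oo[) moment_integrand p x y.

Lemma powRDr1 p y : 0 < y -> y `^ (p + 1) = y * y `^ p.
Proof. by move=> y0; rewrite powRD ?(gt_eqF y0) ?implybT// powRr1 ?ltW// mulrC. Qed.

Lemma moment_integrand_ge0 p x y : 0 <= moment_integrand p x y.
Proof. by rewrite mulr_ge0 ?powR_ge0 ?expR_ge0. Qed.

Lemma is_derive_moment_integrand p x y : 0 < y ->
  is_derive y 1 (moment_integrand (p + 1) x)
    ((p + 1) * moment_integrand p x y -
     (moment_integrand (p + 1 + 1) x y - x * moment_integrand (p + 1) x y)).
Proof.
move=> y0; rewrite /moment_integrand; have dp := is_derive1_powR (p + 1) y0.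
apply: is_derive_eq; rewrite /GRing.scale/= addrK !powRDr1//.
by field.
Qed.

Lemma continuous_moment_integrand p x y :
  0 < y -> {for y, continuous (moment_integrand p x)}.
Proof.
move=> y0; apply: differentiable_continuous; apply/derivable1_diffP.
rewrite -(subrK 1 p).
have dm := is_derive_moment_integrand (p - 1) x y0.
exact: ex_derive.
Qed.

Lemma measurable_moment_integrand p x (D := `]0, +oo[%classic : set R) :
  measurable_fun D (moment_integrand p x).
Proof.
apply: open_continuous_measurable_fun => // y.
by rewrite inE /D set_itvE; exact: continuous_moment_integrand.
Qed.

(** Comparison with [f], the derivative of the bounded increasing function [(y / (1 + y))^(p + 1)],
    which has the same singularity [y^p] at 0. *)
Lemma integrable_moment p x : -1 < p ->
  leb.-integrable `]0, +oo[ (EFin \o moment_integrand p x).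
Proof.
move=> p1.
pose f y : R := (p + 1) * (y / (1 + y)) `^ p * (1 + y) ^- 2.
have dq y : 0 < y -> is_derive y 1 (fun y : R => y / (1 + y)) ((1 + y) ^- 2).
  move=> y0; have y1 : 1 + y != 0 by lra.
  by apply: is_derive_eq; rewrite /GRing.scale/=; field.
have q0 y : 0 < y -> 0 < y / (1 + y) by move=> y0; rewrite divr_gt0//; lra.
have intf : leb.-integrable `]0, +oo[ (EFin \o f).
  apply: (@ge0_integrable_FTC_0y _ (fun y => (y / (1 + y)) `^ (p + 1)) _ 1).
  - move=> y y0.
    have := @is_derive1_comp _ (fun u : R => u `^ (p + 1)) (fun y : R => y / (1 + y))
      _ _ _ (is_derive1_powR (p + 1) (q0 _ y0)) (dq _ y0).
    by rewrite addrK.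
  - move=> y y0; apply: differentiable_continuous; apply/derivable1_diffP.
    have := dq _ y0; have := q0 _ y0 => qy0 dqy.
    have y1 : 1 + y != 0 by lra.
    rewrite /f; apply: derivableM; last first.
      by apply: derivableV; rewrite ?expf_neq0.
    apply: derivableM => //.
    have dpq := @is_derive1_comp _ (fun u : R => u `^ p)
      (fun y : R => y / (1 + y)) _ _ _ (is_derive1_powR p qy0) dqy.
    exact: ex_derive.
  - move=> y y0; rewrite /f !mulr_ge0 ?powR_ge0 ?invr_ge0 ?sqr_ge0//; lra.
  - move=> y w y0 w0.
    rewrite lerBlDr ler_wpDr ?powR_ge0//.
    apply: (@le_trans _ _ (1 `^ (p + 1))); last by rewrite powR1.
    apply: ge0_ler_powR; rewrite ?nnegrE ?ler01 ?ltW ?q0//; first lra.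
    by rewrite ltr_pdivrMr; lra.
(* Since [ln (1 + y) <= y], the factor [(1 + y) `^ s] is absorbed by the Gaussian. *)
pose s := p + 2; pose C := expR (s * x + s ^+ 2 / 2) / (p + 1).
have : leb.-integrable `]0, +oo[ (EFin \o (fun y => C * f y)).
  rewrite (_ : EFin \o _ = (fun y => C%:E * (EFin \o f) y)%E)//.
  by apply: integrableZl; first exact: measurable_itv.
apply: le_integrable; first exact: measurable_itv.
  by apply/measurable_EFinP; apply: measurable_moment_integrand.
move=> y; rewrite set_itvE/= => y0.
have y1 : 0 < 1 + y by lra.
have p0 : 0 < p + 1 by lra.
have y1s : (1 + y) `^ s <= expR (s * y).
  rewrite /powR gt_eqF// ler_expR ler_wpM2l ?le_ln1Dx//; rewrite /s; lra.
rewrite lee_fin !ger0_norm ?moment_integrand_ge0//; last first.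
  by rewrite /f !mulr_ge0 ?powR_ge0 ?invr_ge0 ?sqr_ge0 ?expR_ge0//; lra.
rewrite /moment_integrand.
have -> : y `^ p = (y / (1 + y)) `^ p * (1 + y) ^- 2 * (1 + y) `^ s.
  rewrite /s powRD; last by rewrite (gt_eqF y1) implybT.
  have -> : (1 + y) `^ 2 = (1 + y) ^+ 2 by rewrite -powR_mulrn ?ltW.
  rewrite powRM ?invr_ge0 ?ltW// -powR_inv1 ?ltW// -powRrM mulN1r powRN.
  have : (1 + y) `^ p != 0 by rewrite gt_eqF// powR_gt0.
  by move=> h; field; rewrite h/= gt_eqF.
rewrite /C /f; set q := _ `^ p * _.
have -> : expR (s * x + s ^+ 2 / 2) / (p + 1) *
    ((p + 1) * (y / (1 + y)) `^ p / (1 + y) ^+ 2) =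
    q * expR (s * x + s ^+ 2 / 2).
  by rewrite /q; field; rewrite !gt_eqF.
rewrite -mulrA ler_wpM2l ?mulr_ge0 ?powR_ge0 ?invr_ge0 ?sqr_ge0//.
apply: (@le_trans _ _ (expR (s * y) * expR (- ((y - x) ^+ 2 / 2)))).
  by rewrite ler_wpM2r ?expR_ge0.
rewrite -expRD ler_expR.
(* Completing the square, [s * y - (y - x)^2 / 2 = s * x + s^2 / 2 - (y - x - s)^2 / 2], which
   explains [C]. *)
have := sqr_ge0 (y - x - s); nra.
Qed.

Lemma integrable_momentZ p x k : -1 < p ->
  leb.-integrable `]0, +oo[ (EFin \o (fun y => k * moment_integrand p x y)).
Proof.
move=> p1.
rewrite (_ : EFin \o _ = (fun y => k%:E * (EFin \o moment_integrand p x) y)%E)//.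
by apply: integrableZl; [exact: measurable_itv|exact: integrable_moment].
Qed.

(** Differentiation under the integral sign, with a domination uniform over parameters in []x - 1, x
    + 1[]. *)
Lemma is_derive_moment p x : -1 < p ->
  is_derive x 1 (moment p) (moment (p + 1) x - x * moment p x).
Proof.
move=> p1; have p2 : -1 < p + 1 by lra.
have dE (a y : R) : 0 < y -> is_derive a 1 (fun a : R => moment_integrand p a y)
    (moment_integrand (p + 1) a y - a * moment_integrand p a y).
  move=> y0; rewrite /moment_integrand.
  by apply: is_derive_eq; rewrite /GRing.scale/= powRDr1//; field.
(* For [a < x + 1] and [y > 0], dropping [a^2] and replacing [a * y] by [(x + 1) * y] bounds the
   Gaussian centred at [a] by [C] times the one centred at [x + 1]. With [|y - a| <= y + |x| + 1]
   this gives the dominating function [G]. *)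
pose C := expR ((x + 1) ^+ 2 / 2).
pose G y := C * moment_integrand (p + 1) (x + 1) y +
  C * (`|x| + 1) * moment_integrand p (x + 1) y.
have Ix : (`]x - 1, x + 1[%classic : set R) x by rewrite set_itvE/=; lra.
have intf (a : R) : (`]x - 1, x + 1[%classic : set R) a ->
    leb.-integrable `]0, +oo[ (EFin \o moment_integrand p a).
  by move=> _; exact: integrable_moment.
have df (a y : R) : (`]x - 1, x + 1[%classic : set R) a -> `]0, +oo[%classic y ->
    derivable (fun a : R => moment_integrand p a y) a 1.
  by move=> _; rewrite set_itvE => y0; have dEa := dE a _ y0; exact: ex_derive.
have G0 y : 0 <= G y.
  rewrite /G; apply: addr_ge0; apply: mulr_ge0.
  - exact: expR_ge0.
  - exact: moment_integrand_ge0.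
  - by apply: mulr_ge0; [exact: expR_ge0|exact: addr_ge0].
  - exact: moment_integrand_ge0.
have intG : leb.-integrable `]0, +oo[ (EFin \o G).
  have := integrableD _ (integrable_momentZ (x + 1) C p2)
    (integrable_momentZ (x + 1) (C * (`|x| + 1)) p1).
  by apply; exact: measurable_itv.
have dfE (a y : R) : 0 < y -> partial1of2 (moment_integrand p) a y =
    moment_integrand (p + 1) a y - a * moment_integrand p a y.
  by move=> /(dE a) ?; rewrite /partial1of2 derive1E derive_val.
have G_ub (a y : R) : (`]x - 1, x + 1[%classic : set R) a -> `]0, +oo[%classic y ->
    `|partial1of2 (moment_integrand p) a y| <= G y.
  rewrite !set_itvE/= => /andP[a1 a2] y0; rewrite dfE// /G /moment_integrand powRDr1//.
  set Y := y `^ p; have Y0 : 0 <= Y by exact: powR_ge0.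
  set ea := expR (- ((y - a) ^+ 2 / 2)).
  have -> : y * Y * ea - a * (Y * ea) = Y * ((y - a) * ea) by ring.
  set ex := expR (- ((y - (x + 1)) ^+ 2 / 2)).
  have -> : C * (y * Y * ex) + C * (`|x| + 1) * (Y * ex) =
     Y * ((y + `|x| + 1) * (C * ex)) by ring.
  rewrite normrM ger0_norm// ler_wpM2l// normrM.
  have xa := ler_norm x.
  apply: ler_pM => //.
    rewrite ler_norml; have := ler_norm (- x); rewrite normrN => ?; lra.
  rewrite ger0_norm ?expR_ge0// /C /ex -expRD ler_expR.
  have := sqr_ge0 a; nra.
have cvgd := @cvg_differentiation_under_integral R _ _ leb (moment_integrand p) _
  (measurable_itv _) x (x - 1) (x + 1) Ix intf df G G0 intG G_ub.
have dM := @derivable_under_integral R _ _ leb (moment_integrand p) _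
  (measurable_itv _) x (x - 1) (x + 1) Ix intf df G G0 intG G_ub.
have -> : moment (p + 1) x - x * moment p x =
    \int[leb]_(y in `]0, +oo[) partial1of2 (moment_integrand p) x y.
  rewrite /moment -RintegralZl//; last exact: integrable_moment.
  rewrite -RintegralB//; [|exact: integrable_moment|exact: integrable_momentZ].
  by apply: eq_Rintegral => y; rewrite inE set_itvE => y0; rewrite dfE.
apply: DeriveDef => //.
by rewrite -derive1E; apply/cvg_lim.
Qed.

(** Integration by parts: the derivative of [moment_integrand (p + 1) x] has integral 0, because
    that function vanishes at both ends of the half-line. *)
Lemma momentDD p x : -1 < p ->
  moment (p + 1 + 1) x = x * moment (p + 1) x + (p + 1) * moment p x.
Proof.
move=> p1; have p2 : -1 < p + 1 by lra. have p3 : -1 < p + 1 + 1 by lra.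
have M1 := integrable_moment x p1; have M2 := integrable_moment x p2.
have M3 := integrable_moment x p3.
have F0 : moment_integrand (p + 1) x y @[y --> 0^'+] --> 0.
  rewrite -[X in _ --> X](mul0r (expR (- ((0 - x) ^+ 2 / 2)))).
  apply: cvgM; first by apply: powR_cvg0; lra.
  apply: cvg_at_right_filter.
  have cg : {for 0 : R, continuous (fun y : R => expR (- ((y - x) ^+ 2 / 2)))}.
    by apply: differentiable_continuous; apply/derivable1_diffP; exact: ex_derive.
  exact: cg.
(* One more than the exponent [p + 1]: completing the square then leaves a factor [exp (- y)], which
   tends to 0. *)
pose s := p + 1 + 1; pose C := expR (s * x + s ^+ 2 / 2).
have Foo : moment_integrand (p + 1) x y @[y --> +oo%R] --> 0.
  apply: (@squeeze_cvgr _ _ _ _ (cst 0) (fun y => C * expR (- y))).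
  - near=> y; rewrite moment_integrand_ge0/= /moment_integrand.
    have y0 : 0 < y by near: y; exact: nbhs_pinfty_gt.
    apply: (@le_trans _ _ (expR ((p + 1) * y) * expR (- ((y - x) ^+ 2 / 2)))).
      rewrite ler_wpM2r ?expR_ge0// /powR gt_eqF// ler_expR ler_wpM2l//; first lra.
      exact/ltW/ln_sublinear.
    rewrite /C -!expRD ler_expR.
    have := sqr_ge0 (y - x - s); rewrite /s; nra.
  - exact: cvg_cst.
  - by rewrite -(mulr0 C); apply: cvgMr; exact: cvgr_expR.
have := Rintegral_FTC_0y (fun y h => is_derive_moment_integrand p x h) _ _ F0 Foo.
have M2x := integrable_momentZ x x p2; have M1p := integrable_momentZ x (p + 1) p1.
have M32 : leb.-integrable `]0, +oo[ (EFin \o (fun y =>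
    moment_integrand (p + 1 + 1) x y - x * moment_integrand (p + 1) x y)).
  by have := integrableB _ M3 M2x; apply; exact: measurable_itv.
rewrite RintegralB// RintegralB// !RintegralZl// subrr => M.
apply/eqP; rewrite -subr_eq0 -[X in _ == X]oppr0 -[X in _ == - X]M => [||].
- by apply/eqP; rewrite /moment; ring.
- move=> y y1; apply: continuousB.
    by apply: continuousM; [exact: cst_continuous|exact: continuous_moment_integrand].
  apply: continuousB; first exact: continuous_moment_integrand.
  by apply: continuousM; [exact: cst_continuous|exact: continuous_moment_integrand].
- by have := integrableB _ M1p M32; apply; exact: measurable_itv.
Unshelve. all: by end_near. Qed.

(** The integrand is nonnegative and has a positive minimum on [[1, 2]], an interval of length 1. *)
Lemma moment_gt0 p x : -1 < p -> 0 < moment p x.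
Proof.
move=> p1.
pose D := `]0, +oo[%classic : set R; pose I := `[1, 2]%classic : set R.
have ID : I `<=` D by move=> y; rewrite /I /D !set_itvE/= => /andP[]; lra.
have cI : {within I, continuous (moment_integrand p x)}.
  apply: continuous_in_subspaceT => y; rewrite inE => /ID; rewrite /D set_itvE.
  exact: continuous_moment_integrand.
have [|c cI12 cmin] := @EVT_min R (moment_integrand p x) 1 2 _ cI; first lra.
have c0 : 0 < moment_integrand p x c.
  rewrite /moment_integrand mulr_gt0 ?expR_gt0 ?powR_gt0//.
  by move: cI12; rewrite in_itv/= => /andP[]; lra.
have finM := integrable_fin_num _ (integrable_moment x p1).
have mI : measurable I by exact: measurable_itv.
rewrite /moment /Rintegral -lte_fin fineK; last by apply: finM; exact: measurable_itv.
apply: (@lt_le_trans _ _ (moment_integrand p x c)%:E); first by rewrite lte_fin.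
apply: (@le_trans _ _ (\int[leb]_(y in I) (moment_integrand p x y)%:E)%E); last first.
  apply: ge0_subset_integral => //.
    by apply/measurable_EFinP; apply: measurable_moment_integrand.
  by move=> y _; rewrite lee_fin moment_integrand_ge0.
have -> : (moment_integrand p x c)%:E =
    (\int[leb]_(y in I) (moment_integrand p x c)%:E)%E.
  rewrite integral_cst// /I.
  have mu1 : leb (`[1, 2]%classic : set R) = 1%E.
    rewrite lebesgue_measure_itv/= lte_fin ifT; last lra.
    by rewrite -EFinB; congr EFin; ring.
  by rewrite -[LHS]mule1 -mu1.
apply: ge0_le_integral => //.
- by move=> y _; rewrite lee_fin ltW.
- apply/measurable_EFinP; apply: (measurable_funS _ ID).
    exact: measurable_itv.
  exact: measurable_moment_integrand.
Qed.

(* For [y, x >= 0], [(y + x)^2 >= y^2 + x^2]. *)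
Lemma moment_tail p x : -1 < p -> 0 <= x ->
  moment p (- x) <= expR (- (x ^+ 2 / 2)) * moment p 0.
Proof.
move=> p1 x0; rewrite /moment -RintegralZl//; last exact: integrable_moment.
apply: le_Rintegral => //; [exact: integrable_moment|exact: integrable_momentZ|].
move=> y; rewrite set_itvE/= => y0.
rewrite /moment_integrand mulrCA -expRD ler_wpM2l ?powR_ge0// ler_expR.
have := mulr_ge0 x0 (ltW y0); nra.
Qed.

End gaussian_moments.

(** * The linear ODE satisfied by [phi] *)

Section phi_ode.
Variables (R : realType) (lam : R).
Hypothesis lam_lt : lam < 1 / 2.
Implicit Types x : R.

Let p_gt : -1 < - (2 * lam).
Proof. move: lam_lt; lra. Qed.

Lemma phi_gt0 x : 0 < phi lam x. Proof. exact: moment_gt0. Qed.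

Lemma phi_tail x : 0 <= x -> phi lam (- x) <= expR (- (x ^+ 2 / 2)) * phi lam 0.
Proof. exact: moment_tail. Qed.

Lemma is_derive_phi x : is_derive x 1 (phi lam) (derive1 (phi lam) x).
Proof.
have dphi := is_derive_moment x p_gt.
by apply: DeriveDef; [exact: ex_derive|rewrite derive1E].
Qed.

(** With [p = - (2 * lam)], differentiating [phi' = moment (p + 1) - x * phi] gives [moment (p + 2)
    - x * moment (p + 1) - phi - x * phi'], and [momentDD] turns the first two terms into
    [(p + 1) * phi]. *)
Lemma is_derive_derive1_phi x :
  is_derive x 1 (derive1 (phi lam))
    (- (2 * lam) * phi lam x - x * derive1 (phi lam) x).
Proof.
have d1E : derive1 (phi lam) =
    (fun x => moment (- (2 * lam) + 1) x - x * phi lam x).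
  apply/funext => u; have dphi := is_derive_moment u p_gt.
  by rewrite derive1E derive_val.
have p1_gt : -1 < - (2 * lam) + 1 by move: p_gt; lra.
have dm := is_derive_moment x p1_gt; have dphi := is_derive_phi x.
rewrite [X in is_derive _ _ X _]d1E; apply: is_derive_eq.
rewrite /GRing.scale/= (momentDD x p_gt) -/(phi lam x) d1E.
rewrite (_ : moment (- (2 * lam)) x = phi lam x)//; ring.
Qed.

Lemma phi_ode x : derive1n 2 (phi lam) x =
  - (2 * lam) * phi lam x - x * derive1 (phi lam) x.
Proof.
have dphi := is_derive_derive1_phi x.
by rewrite /derive1n/= derive1E derive_val.
Qed.

End phi_ode.

(* The second-order subjet of [g] at [x], in a form without error terms. *)
Definition lower_jet (R : realType) (g : R -> R) (x p m : R) : Prop :=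
  forall m', m' < m ->
    \forall y \near x, g x + p * (y - x) + m' / 2 * (y - x) ^+ 2 <= g y.

(** * Calculus of second-order lower jets *)

Section lower_jets.
Variable R : realType.
Implicit Types (f g : R -> R) (x p m : R).

(** The difference [r] of [g] and the quadratic vanishes at [x]. By the mean value theorem its sign
    is read off [r'], and [r' c] has the sign of [c - x] because the difference quotient of [dg] at
    [x] exceeds [m'] nearby. *)
Lemma lower_jet_derive g (dg : R -> R) x m :
  (forall y : R, is_derive y 1 g (dg y)) -> is_derive x 1 dg m ->
  lower_jet g x (dg x) m.
Proof.
move=> dgE ddg m' m'm.
pose r (y : R) : R := g y - (g x + dg x * (y - x) + m' / 2 * (y - x) ^+ 2).
have dr (y : R) : is_derive y 1 r (dg y - (dg x + m' * (y - x))).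
  rewrite /r; have dgy := dgE y.
  by apply: is_derive_eq; rewrite /GRing.scale/=; field.
have cr (a b : R) : {within `[a, b], continuous r}.
  by apply: derivable_within_continuous => u _; have dru := dr u; exact: ex_derive.
have slope : \forall h \near (0:R)^', m' < h^-1 * (dg (h + x) - dg x).
  have [dgx dgxE] := ddg.
  have : h^-1 *: (dg (h *: 1 + x) - dg x) @[h --> 0^'] --> m.
    by rewrite -dgxE; exact: dgx.
  move=> /cvgr_gt/(_ _ m'm).
  by apply: filterS => h; rewrite /GRing.scale/= mulr1.
move: slope; rewrite near_withinE => -[e /= e0 He].
exists e => //= y; rewrite /ball_/= => yxe.
have rx : r x = 0 by rewrite /r; ring.
rewrite -subr_ge0 -/(r y).
have key u : u != x -> `|x - u| < e -> m' < (u - x)^-1 * (dg u - dg x).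
  move=> ux xu; have := He (u - x).
  rewrite /ball_/= sub0r normrN distrC subr_eq0 subrK.
  by apply.
have [xy|yx|<-] := ltgtP x y; last by rewrite rx.
- have [c cxy] := MVT xy (fun u _ => dr u) (cr x y).
  rewrite rx subr0 => ->; move: cxy; rewrite in_itv/= => /andP[xc cy].
  have := key c; rewrite gt_eqF// => /(_ isT).
  have xcE : `|x - c| < e.
    apply: le_lt_trans yxe.
    by rewrite !ltr0_norm ?subr_lt0//; lra.
  move=> /(_ xcE); rewrite mulrC ltr_pdivlMr ?subr_gt0// => h.
  by rewrite mulr_ge0 ?subr_ge0 ?ltW//; lra.
- have [c cxy] := MVT yx (fun u _ => dr u) (cr y x).
  rewrite rx sub0r => /eqP; rewrite eqr_oppLR => /eqP ->.
  move: cxy; rewrite in_itv/= => /andP[yc cx].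
  have := key c; rewrite lt_eqF// => /(_ isT).
  have xcE : `|x - c| < e.
    apply: le_lt_trans yxe.
    by rewrite !gtr0_norm ?subr_gt0//; lra.
  move=> /(_ xcE); rewrite mulrC ltr_ndivlMr ?subr_lt0// => h.
  by rewrite -mulNr; apply: mulr_ge0; lra.
Qed.

(** Made for the junction of two formulas: each nearby point inherits the inequality from the
    formula valid there, so one-sided derivatives never appear. *)
Lemma lower_jet_glue f1 f2 g x p m :
  (\forall y \near x, g y = f1 y \/ g y = f2 y) ->
  g x = f1 x -> g x = f2 x ->
  lower_jet f1 x p m -> lower_jet f2 x p m -> lower_jet g x p m.
Proof.
move=> gE g1 g2 j1 j2 m' m'm; near=> y.
have : g y = f1 y \/ g y = f2 y by near: y.
by move=> [->|->]; [rewrite g1; near: y; exact: j1|rewrite g2; near: y; exact: j2].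
Unshelve. all: by end_near. Qed.

Lemma lower_jet_near f g x p m :
  (\forall y \near x, g y = f y) -> lower_jet f x p m -> lower_jet g x p m.
Proof.
move=> gE j; have gx := nbhs_singleton gE.
by apply: (lower_jet_glue _ gx gx j j); apply: filterS gE => y ->; left.
Qed.

Lemma lower_jetD f g x p q m n : lower_jet f x p m -> lower_jet g x q n ->
  lower_jet (fun y => f y + g y) x (p + q) (m + n).
Proof.
(* The slack [m + n - k] is shared equally: [(m - d) + (n - d) = k]. *)
move=> jf jg k kmn; pose d := (m + n - k) / 2.
have jfd : m - d < m by rewrite /d; lra.
have jgd : n - d < n by rewrite /d; lra.
near=> y.
have hf : f x + p * (y - x) + (m - d) / 2 * (y - x) ^+ 2 <= f y.
  by near: y; exact: jf.
have hg : g x + q * (y - x) + (n - d) / 2 * (y - x) ^+ 2 <= g y.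
  by near: y; exact: jg.
apply: le_trans (lerD hf hg); rewrite le_eqVlt; apply/orP; left; apply/eqP.
by rewrite /d; field.
Unshelve. all: by end_near. Qed.

Lemma lower_jet_even g x p m : (forall y, g (- y) = g y) ->
  lower_jet g x p m -> lower_jet g (- x) (- p) m.
Proof.
move=> ge j m' /j [e /= e0 He]; exists e => //= y.
rewrite /ball_/= => xy; have := He (- y); rewrite /ball_/= opprK.
rewrite -normrN opprD => /(_ xy); rewrite !ge; apply: le_trans.
by rewrite le_eqVlt; apply/orP; left; apply/eqP; ring.
Qed.

End lower_jets.

(** * Order properties of the nonlinearity [G] *)

Section G_facts.
Variables (R : realType) (sigma : R).
Hypotheses (sigma_gt0 : 0 < sigma) (sigma_lt1 : sigma < 1).
Implicit Types m n k t : R.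

Let sigma2_gt0 : 0 < sigma ^+ 2. Proof. exact: exprn_gt0. Qed.
Let sigma2_lt1 : sigma ^+ 2 < 1.
Proof. by rewrite expr_lt1// ltW. Qed.

Lemma G_ge0E m : 0 <= m -> 2 * G sigma m = m.
Proof.
move=> m0; rewrite /G /neg_part /pos_part max_r// max_l ?oppr_le0//.
by rewrite mulr0 subr0 mulrA divff ?mul1r// pnatr_eq0.
Qed.

Lemma G_le0E m : m <= 0 -> 2 * G sigma m = sigma ^+ 2 * m.
Proof.
move=> m0; rewrite /G /neg_part /pos_part max_l// max_r ?oppr_ge0//.
by field.
Qed.

(** As [sigma^2 < 1], [2 * G sigma m] is the maximum of [m] and [sigma^2 * m]. This bound serves the
    outer part of the profile, [le_2G_sigma] the inner part. *)
Lemma le_2G_1 m : m <= 2 * G sigma m.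
Proof.
have [m0|/ltW m0] := leP 0 m; first by rewrite G_ge0E.
by rewrite (G_le0E m0) ler_niMl// ltW.
Qed.

Lemma le_2G_sigma m : sigma ^+ 2 * m <= 2 * G sigma m.
Proof.
have [m0|/ltW m0] := leP 0 m; last by rewrite G_le0E.
by rewrite (G_ge0E m0) ler_piMl// ltW.
Qed.

Lemma le_2G m n : m <= n -> 2 * G sigma m <= 2 * G sigma n.
Proof.
move=> mn; have [m0|/ltW m0] := leP 0 m.
  by rewrite (G_ge0E m0) (le_trans mn) ?le_2G_1.
by rewrite (G_le0E m0) (le_trans _ (le_2G_sigma n)) ?ler_pM2l.
Qed.

(** The slopes of [2 * G] are [sigma^2] and 1, so lowering the argument by [t] costs at most [t]. *)
Lemma le_2GB m t : 0 <= t -> 2 * G sigma m - t <= 2 * G sigma (m - t).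
Proof.
move=> t0; have [m0|/ltW m0] := leP 0 m.
  by rewrite (G_ge0E m0) le_2G_1.
rewrite (G_le0E m0) (le_trans _ (le_2G_sigma _))// mulrBr lerD2l lerN2.
by rewrite ler_piMl// ltW.
Qed.

Lemma GZ k m : 0 <= k -> G sigma (k * m) = k * G sigma m.
Proof.
move=> k0; have mx u : Num.max 0 (k * u) = k * Num.max 0 u.
  by rewrite maxr_pMr// mulr0.
by rewrite /G /neg_part /pos_part -(mulrN k m) !mx; field.
Qed.

End G_facts.

(** * The glued profile for [lambda_sigma] *)

(** The later argument uses the profile as a subsolution; lower jets let the junction be treated
    like any other point. The tail bound makes the profile negligible against [exp (- x^2 / 4)]. *)
Lemma profile_exists (R : realType) (sigma lam : R) :
  0 < sigma -> sigma < 1 -> lam < 1 / 2 -> sigma_of lam = sigma ->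
  exists y : R -> R,
    [/\ continuous y, forall x, 0 < y x,
        exists c C : R, forall x, c <= `|x| -> y x <= C * expR (- (x ^+ 2 / 2))
      & forall x, exists p m : R, lower_jet y x p m /\
          - (2 * lam) * y x <= 2 * G sigma m + x * p].
Proof.
move=> s0 s1 lam_lt sE.
(* The default value 0 of [xget] is excluded: if either root were 0, the quotient [sigma_of lam]
   would be 0, division by 0 included, against [0 < sigma]. *)
have [x1_0 z_0] : x1 lam != 0 /\ z lam != 0.
  split; apply/eqP => h; move: sE; rewrite /sigma_of h ?invr0 ?oppr0 ?mulr0 ?mul0r => sE;
    by move: s0; rewrite -sE ltxx.
have [x1_lt0 x1E] : x1 lam < 0 /\ derive1n 2 (phi lam) (x1 lam) = 0.
  move: x1_0; rewrite /x1; case: xgetP => [y -> //|_]; by rewrite eqxx.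
have [z_gt0 zE] : 0 < z lam /\
    derive1n 2 (phi lam) (z lam) + derive1n 2 (phi lam) (- z lam) = 0.
  move: z_0; rewrite /z; case: xgetP => [y -> //|_]; by rewrite eqxx.
pose c := - x1 lam; have c0 : 0 < c by rewrite /c oppr_gt0.
(* At [x = c] the inner argument [x / sigma] reaches [z lam] while the outer argument [- x] reaches
   [x1 lam]. *)
have czE : c / sigma = z lam.
  by rewrite /c -sE /sigma_of invf_div mulrCA divff ?mulr1// oppr_eq0.
pose ph := phi lam; pose ph' : R -> R := derive1 ph.
have ph0 (x : R) : 0 < ph x by exact: phi_gt0.
have dph (x : R) : is_derive x 1 ph (ph' x) by exact: is_derive_phi.
have dph' (x : R) : is_derive x 1 ph' (- (2 * lam) * ph x - x * ph' x).
  exact: is_derive_derive1_phi.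
have ph_tail (x : R) : 0 <= x -> ph (- x) <= expR (- (x ^+ 2 / 2)) * ph 0.
  exact: phi_tail.
(* The ODE for [phi] restates the defining equations of [x1] and [z] without second derivatives. *)
have phc : - (2 * lam) * ph (- c) - - c * ph' (- c) = 0.
  by rewrite -(phi_ode lam_lt) /c opprK.
have phz : - (2 * lam) * ph (c / sigma) - c / sigma * ph' (c / sigma) +
    (- (2 * lam) * ph (- (c / sigma)) - - (c / sigma) * ph' (- (c / sigma))) = 0.
  by rewrite -!(phi_ode lam_lt) czE.
clearbody ph ph' c; clear x1_0 z_0 x1_lt0 x1E z_gt0 zE czE sE.
have s_neq0 : sigma != 0 by rewrite gt_eqF.
pose A (x : R) : R := ph (x / sigma) + ph (- (x / sigma)).
pose A' (x : R) : R := (ph' (x / sigma) - ph' (- (x / sigma))) / sigma.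
(* By scaling, [A] solves [sigma^2 * A'' + x * A' + 2 * lam * A = 0], and [B] below solves
   [B'' + x * B' + 2 * lam * B = 0]; the constant [b] matches their values at [c]. *)
pose A'' (x : R) : R := - (2 * lam * A x + x * A' x) / sigma ^+ 2.
pose b := A c / ph (- c).
pose B (x : R) : R := b * ph (- x).
pose B' (x : R) : R := - b * ph' (- x).
pose B'' (x : R) : R := - (2 * lam * B x + x * B' x).
have A0 (x : R) : 0 < A x by rewrite addr_gt0.
have b0 : 0 < b by rewrite divr_gt0.
have dA (x : R) : is_derive x 1 A (A' x).
  have d1 := dph (x / sigma); have d2 := dph (- (x / sigma)).
  by rewrite /A /A'; apply: is_derive_eq; rewrite /GRing.scale/=; field.
have dA' (x : R) : is_derive x 1 A' (A'' x).
  have d1 := dph' (x / sigma); have d2 := dph' (- (x / sigma)).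
  by rewrite /A'' /A /A'; apply: is_derive_eq; rewrite /GRing.scale/=; field.
have dB (x : R) : is_derive x 1 B (B' x).
  have d1 := dph (- x).
  by rewrite /B /B'; apply: is_derive_eq; rewrite /GRing.scale/=; ring.
have dB' (x : R) : is_derive x 1 B' (B'' x).
  have d1 := dph' (- x).
  by rewrite /B'' /B /B'; apply: is_derive_eq; rewrite /GRing.scale/=; ring.
have BcE : B c = A c by rewrite /B /b divfK// gt_eqF.
have A''c : A'' c = 0.
  rewrite /A'' /A /A' mulNr; apply/eqP; rewrite oppr_eq0 mulf_eq0; apply/orP; left.
  by apply/eqP; rewrite -[RHS]oppr0 -phz; field.
have B''c : B'' c = 0.
  rewrite /B'' /B /B'.
  rewrite (_ : - _ = b * (- (2 * lam) * ph (- c) - - c * ph' (- c))); last by ring.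
  by rewrite phc mulr0.
(* Both second derivatives vanish at [c], so either ODE reduces to [c] times the slope being
   [- 2 * lam] times the value, and the values agree. *)
have B'cE : B' c = A' c.
  have cn0 : c != 0 by rewrite gt_eqF.
  apply: (mulfI cn0).
  have hB : c * B' c = - (2 * lam * B c) by move: B''c; rewrite /B''; lra.
  have hA : c * A' c = - (2 * lam * A c).
    move: A''c => /eqP; rewrite /A'' mulNr oppr_eq0 mulf_eq0 invr_eq0 expf_eq0/=.
    by rewrite (negPf s_neq0) orbF => /eqP; lra.
  by rewrite hA hB BcE.
have A_even (x : R) : A (- x) = A x by rewrite /A mulNr opprK addrC.
(* [y] is [A] on [`|x| <= c] and [B `|x|] elsewhere, written so that continuity is
   immediate. *)
pose y (x : R) : R := A (Num.min `|x| c) + B (Num.max `|x| c) - B c.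
have y_in (x : R) : `|x| <= c -> y x = A x.
  move=> xc; rewrite /y min_l// max_r// addrK.
  by have [x0|x0] := leP 0 x; [rewrite ger0_norm|rewrite ltr0_norm// A_even].
have y_out (x : R) : c <= `|x| -> y x = B `|x|.
  by move=> xc; rewrite /y min_r// max_l// BcE addrAC subrr add0r.
have y_even (x : R) : y (- x) = y x by rewrite /y normrN.
have jet_ge0 (x : R) : 0 <= x -> exists p m : R, lower_jet y x p m /\
    - (2 * lam) * y x <= 2 * G sigma m + x * p.
  move=> x0.
  (* Since [2 * G sigma m] dominates both [sigma^2 * m] and [m], the two linear ODEs give the
     inequality whatever the signs of [A''] and [B'']. *)
  have odeA : - (2 * lam) * A x <= 2 * G sigma (A'' x) + x * A' x.
    rewrite -lerBlDr; apply: le_trans (le_2G_sigma s0 s1 _).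
    by rewrite le_eqVlt; apply/orP; left; apply/eqP; rewrite /A''; field.
  have odeB : - (2 * lam) * B x <= 2 * G sigma (B'' x) + x * B' x.
    rewrite -lerBlDr; apply: le_trans (le_2G_1 s0 s1 _).
    by rewrite le_eqVlt; apply/orP; left; apply/eqP; rewrite /B''; ring.
  have jA := lower_jet_derive dA (dA' x).
  have jB := lower_jet_derive dB (dB' x).
  have [xc|cx|xc] := ltgtP x c.
  - exists (A' x), (A'' x); rewrite y_in ?ger0_norm ?(ltW xc)//; split => //.
    apply: lower_jet_near jA; near=> u; apply: y_in; apply: ltW.
    near: u. apply: (cvgr_lt `|x|); last by rewrite ger0_norm.
    exact: norm_continuous.
  - exists (B' x), (B'' x); rewrite y_out ?ger0_norm ?(ltW cx)//; split => //.
    apply: lower_jet_near jB; near=> u.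
    have cu : c < u by near: u; exact: lt_nbhsr.
    by rewrite y_out ger0_norm//; lra.
  (* At the junction both formulas have the same value, the same slope and second derivative 0,
     hence a common jet. *)
  - exists (A' x), 0; rewrite y_in; last by rewrite ger0_norm// xc.
    move: jA jB odeA; rewrite xc A''c B''c B'cE => jA jB odeA; split => //.
    apply: (lower_jet_glue _ _ _ jA jB).
    + near=> u; have u0 : 0 < u by near: u; exact: lt_nbhsr.
      have [uc|cu] := leP u c; [left|right].
        by rewrite y_in ?gtr0_norm.
      by rewrite y_out gtr0_norm// ltW.
    + by rewrite y_in ?gtr0_norm.
    + by rewrite y_in ?gtr0_norm// BcE.
exists y; split.
- have cA (x : R) : {for x, continuous A}.
    by apply: differentiable_continuous; apply/derivable1_diffP; have d := dA x.
  have cB (x : R) : {for x, continuous B}.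
    by apply: differentiable_continuous; apply/derivable1_diffP; have d := dB x.
  rewrite /y => x; apply: (@continuousB _ _ _ (fun x => A _ + B _) (cst (B c)));
    last exact: cst_continuous.
  apply: continuousD.
    apply: (@continuous_comp _ _ _ (fun x : R => Num.min `|x| c) A); last exact: cA.
    by apply: continuous_min; [exact: norm_continuous|exact: cst_continuous].
  apply: (@continuous_comp _ _ _ (fun x : R => Num.max `|x| c) B); last exact: cB.
  by apply: continuous_max; [exact: norm_continuous|exact: cst_continuous].
- by move=> x; have [xc|/ltW xc] := leP `|x| c; [rewrite y_in|rewrite y_out// mulr_gt0].
- exists c, (b * ph 0) => x xc; rewrite y_out// /B -mulrA ler_pM2l//.
  by rewrite mulrC -[x ^+ 2]real_normK ?num_real//; exact: ph_tail.
- move=> x; have [/jet_ge0//|x0] := leP 0 x.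
  have [|p [m [j h]]] := jet_ge0 (- x); first by rewrite oppr_ge0 ltW.
  exists (- p), m; split; first by have := lower_jet_even y_even j; rewrite opprK.
  by move: h; rewrite y_even mulrN (mulNr x).
Unshelve. all: by end_near. Qed.

(** * The strict subsolution and its contact with a positive function *)

Lemma lower_jet_gaussian (R : realType) (k x : R) :
  lower_jet (fun y => - k * expR (- (y ^+ 2 / 4))) x
    (k * (x / 2) * expR (- (x ^+ 2 / 4)))
    (k * (1 / 2 - x ^+ 2 / 4) * expR (- (x ^+ 2 / 4))).
Proof.
have dw (y : R) : is_derive y 1 (fun y => - k * expR (- (y ^+ 2 / 4)))
    (k * (y / 2) * expR (- (y ^+ 2 / 4))).
  by apply: is_derive_eq; rewrite /GRing.scale/=; field.
apply: (lower_jet_derive dw).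
by apply: is_derive_eq; rewrite /GRing.scale/=; field.
Qed.

(** The common source of both claims: a solution of the ODE, classical or viscosity, would force the
    last expression to be nonpositive at the contact point. *)
Lemma positive_touching_jet (R : realType) (sigma lam0 lam : R) (H : R -> R) :
  0 < sigma -> sigma < 1 -> sigma_of lam0 = sigma ->
  0 < lam0 -> lam0 < lam -> lam < 1 / 2 -> continuous H -> (forall x, 0 < H x) ->
  exists x p m : R,
    (\forall y \near x, H x + p * (y - x) + m / 2 * (y - x) ^+ 2 <= H y) /\
    0 < 2 * G sigma m + x * p + 2 * lam * H x.
Proof.
move=> s0 s1 sE lam0_gt0 lam0_lt lam_lt cH H0.
have lam0_lt2 : lam0 < 1 / 2 by lra.
have [y0 [cy0 y0_gt0 [c [C tail]] jets]] := profile_exists s0 s1 lam0_lt2 sE.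
pose w (x : R) : R := expR (- (x ^+ 2 / 4)).
have w0 x : 0 < w x by exact: expR_gt0.
have w1 x : w x <= 1.
  by rewrite -expR0 ler_expR oppr_le0 divr_ge0 ?sqr_ge0.
have cw : continuous w.
  move=> x; apply: differentiable_continuous; apply/derivable1_diffP.
  exact: ex_derive.
(* On [[-2, 2]] the Gaussian must be beaten by the gain [(lam - lam0) * y0], so [e] is this gain
   taken at the minimum of [y0] there. *)
have [|mu0 _ mu_min] := @EVT_min R y0 (- 2) 2 _ (continuous_subspaceT cy0).
  lra.
pose e := (lam - lam0) * y0 mu0.
have e0 : 0 < e by rewrite mulr_gt0// subr_gt0.
pose v x : R := y0 x + - e * w x.
have cv : continuous v.
  move=> x; apply: (@continuousD _ _ _ y0 (fun x => - e * w x)); first exact: cy0.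
  by apply: continuousM; [exact: cst_continuous|exact: cw].
(* [v] is a strict subsolution for the eigenvalue [lam]: the Gaussian is a
   supersolution where [x ^+ 2 >= 4], and [e] is small on the rest. *)
have vjets x : exists p m : R,
    lower_jet v x p m /\ 0 < 2 * G sigma m + x * p + 2 * lam * v x.
  have [p [m [j ineq]]] := jets x.
  have jv := lower_jetD j (@lower_jet_gaussian R e x).
  do 2 eexists; split; first exact: jv.
  rewrite -/(w x) /v; set W := w x; set X := x ^+ 2 / 4.
  have X0 : 0 <= X by rewrite divr_ge0 ?sqr_ge0.
  have eW0 : 0 < e * W by exact: mulr_gt0 e0 (w0 x).
  (* The term [e * W / 2] is dropped by monotonicity, and the loss is at most [e * W * X]; the
     first-order term contributes twice that amount. *)
  have GW : 2 * G sigma m - e * W * X <=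
      2 * G sigma (m + e * (1 / 2 - X) * W).
    have h := le_2GB s0 s1 m (mulr_ge0 (ltW eW0) X0); apply: (le_trans h).
    by apply: le_2G => //; lra.
  have y0x : 0 < (lam - lam0) * y0 x by rewrite mulr_gt0// subr_gt0.
  suff : 0 < 2 * ((lam - lam0) * y0 x) + e * W * (X - 2 * lam).
    have -> : x * (p + e * (x / 2) * W) = x * p + 2 * (e * W * X).
      by rewrite /X; field.
    by move: GW ineq; lra.
  have [X1|X1] := leP 1 X.
    have : 0 <= e * W * (X - 2 * lam) by apply: mulr_ge0; lra.
    by lra.
  have ey : e <= (lam - lam0) * y0 x.
    rewrite ler_pM2l ?subr_gt0// mu_min// in_itv/= -ler_norml.
    by rewrite -ler_sqr ?nnegrE// real_normK ?num_real//; move: X1; rewrite /X; lra.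
  have eWe : e * W <= e by rewrite ler_piMr ?w1// ltW.
  have : 0 <= e * W * (X + (1 - 2 * lam)) by apply: mulr_ge0; lra.
  by lra.
have [a a0 v_out] : exists2 a : R, 0 < a & forall x, a < `|x| -> v x <= 0.
  (* Beyond [c] the tail bound gives [y0 <= C * w^2]. Beyond 2 and [2 * (C / e)] one has [C / e <=
     |x| / 2 <= x^2 / 4 <= exp (x^2 / 4)], that is [C * w <= e]. *)
  exists (Num.max c (Num.max 2 (2 * (C / e)))); first by rewrite !lt_max ltr0n orbT.
  move=> x; rewrite !gt_max => /and3P[cx x2 xC].
  rewrite /v mulNr subr_le0 (le_trans (tail x (ltW cx)))//.
  have -> : expR (- (x ^+ 2 / 2)) = w x * w x.
    by rewrite /w -expRD; congr expR; field.
  rewrite mulrA ler_pM2r// /w expRN ler_pdivrMr ?expR_gt0//.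
  have : x ^+ 2 / 4 <= expR (x ^+ 2 / 4).
    by apply: le_trans (expR_ge1Dx _); rewrite lerDr.
  have x4 : `|x| / 2 <= x ^+ 2 / 4.
    have : 0 <= `|x| * (`|x| - 2) by rewrite mulr_ge0// subr_ge0 ltW.
    by rewrite -[x ^+ 2]real_normK ?num_real//; lra.
  have : C / e <= x ^+ 2 / 4 by lra.
  by rewrite ler_pdivrMr// => h1 h2; apply: (le_trans h1); rewrite mulrC ler_pM2l.
have v00 : 0 < v 0.
  rewrite /v /w expr0n mul0r oppr0 expR0 mulr1 subr_gt0 /e.
  have mu00 : y0 mu0 <= y0 0 by rewrite mu_min// in_itv/= oppr_le0 !ler0n.
  by apply: lt_le_trans mu00; rewrite gtr_pMl//; lra.
pose r x := v x / H x.
have cr : continuous r.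
  move=> x; apply: continuousM; first exact: cv.
  by apply: continuousV; [rewrite gt_eqF|exact: cH].
have [|x _ rmax] := @EVT_max R r (- a) a _ (continuous_subspaceT cr); first lra.
have rx0 : 0 < r x.
  apply: (@lt_le_trans _ _ (r 0)); first by rewrite divr_gt0.
  by apply: rmax; rewrite in_itv/= oppr_le0 !ltW.
(* The maximum over [[-a, a]] is global because it is positive and [v <= 0] outside; thus [v / r x]
   touches [H] from below at [x]. *)
have vH y : v y <= r x * H y.
  rewrite -ler_pdivrMr//; have [ya|ya] := leP `|y| a.
    by apply: rmax; rewrite in_itv/= -ler_norml.
  by apply: (le_trans _ (ltW rx0)); rewrite pmulr_lle0 ?invr_gt0// v_out.
have vx : v x = r x * H x by rewrite /r divfK// gt_eqF.
have [p [m [j ineq]]] := vjets x.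
(* A jet only yields quadratics with coefficient below [m]. Lowering [m] by half of the strict gap
   costs at most [d] and leaves at least [d]. *)
pose d := (2 * G sigma m + x * p + 2 * lam * v x) / 2.
have d0 : 0 < d by rewrite divr_gt0.
have mdm : m - d < m by lra.
exists x, (p / r x), ((m - d) / r x); split.
  near=> y.
  have jy : v x + p * (y - x) + (m - d) / 2 * (y - x) ^+ 2 <= v y.
    by near: y; exact: j.
  rewrite -(ler_pM2l rx0) (le_trans _ (vH y))// (le_trans _ jy)// vx.
  by rewrite le_eqVlt; apply/orP; left; apply/eqP; field; rewrite gt_eqF.
have rV0 : 0 <= (r x)^-1 by rewrite invr_ge0 ltW.
rewrite (mulrC (m - d)) GZ//.
have -> : H x = (r x)^-1 * v x by rewrite vx mulKf// gt_eqF.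
rewrite (_ : _ + _ =
  (r x)^-1 * (2 * G sigma (m - d) + x * p + 2 * lam * v x)); last by ring.
rewrite mulr_gt0 ?invr_gt0//.
by have := le_2GB s0 s1 m (ltW d0); rewrite /d; lra.
Unshelve. all: by end_near. Qed.

(** * Quadratics touching a [C2] function from below *)

(** Testing [x + t] and [x - t] gives [|a| + b * t <= 0] for all small [t > 0]. *)
Lemma quadratic_near_le0 (R : realType) (a b x : R) :
  (\forall y \near x, a * (y - x) + b * (y - x) ^+ 2 <= 0) -> a = 0 /\ b <= 0.
Proof.
move=> -[e /= e0 He].
have key t : 0 < t -> t < e -> `|a| + b * t <= 0.
  move=> t0 te.
  have hp : a * t + b * t ^+ 2 <= 0.
    have := He (x + t); rewrite /ball_/= opprD addNKr normrN gtr0_norm// => /(_ te).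
    by rewrite addrAC subrr add0r.
  have hn : - (a * t) + b * t ^+ 2 <= 0.
    have := He (x - t); rewrite /ball_/= opprB addrCA subrr addr0 gtr0_norm// => /(_ te).
    by rewrite addrAC subrr add0r mulrN sqrrN.
  rewrite -(pmulr_lle0 _ t0) mulrDl.
  have [a0|/ltW a0] := leP 0 a.
    by rewrite (ger0_norm a0) -mulrA.
  by rewrite (ler0_norm a0) -mulrA mulNr.
have b0 : b <= 0.
  have e2 : 0 < e / 2 by rewrite divr_gt0.
  have := key _ e2; have := normr_ge0 a => a0 /(_ _)/= h.
  rewrite -(pmulr_lle0 _ e2); have : `|a| + b * (e / 2) <= 0 by apply: h; lra.
  by lra.
split => //; apply/eqP/negPn/negP => a0.
have na0 : 0 < `|a| by rewrite normr_gt0.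
(* This choice gives [- b * t < |a| / 2], contradicting [key]; [1 - b] keeps the denominator
   positive when [b = 0]. *)
pose t := Num.min (e / 2) (`|a| / (2 * (1 - b))).
have t0 : 0 < t by rewrite lt_min !divr_gt0//; lra.
have te : t < e by rewrite gt_min; apply/orP; left; lra.
have tb : t * (2 * (1 - b)) <= `|a|.
  by rewrite -ler_pdivlMr ?ge_min ?lexx ?orbT//; lra.
have := key t t0 te; nra.
Qed.

(** Adding the quadratic below [y] to one below [- y], supplied by [lower_jet_derive], cancels [y]
    and leaves a quadratic that is nonpositive near [x]. *)
Lemma C2_quadratic_below (R : realType) (y : R -> R) (x p m : R) : C2 y ->
  (\forall u \near x, y x + p * (u - x) + m / 2 * (u - x) ^+ 2 <= y u) ->
  p = derive1 y x /\ m <= derive1n 2 y x.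
Proof.
move=> [dy dy' _] touch.
have dy1 (u : R) : is_derive u 1 y (derive1 y u).
  by apply: DeriveDef; [exact: dy|rewrite derive1E].
have dy2 : is_derive x 1 (derive1 y) (derive1n 2 y x).
  by apply: DeriveDef; [exact: dy'|rewrite /derive1n/= derive1E].
move: (derive1n 2 y x) dy2 => y2; move: (derive1 y) dy1 => y1 dy1 dy2.
have dNy (u : R) : is_derive u 1 (fun u => - y u) (- y1 u) by exact: is_deriveN.
have dNy' : is_derive x 1 (fun u => - y1 u) (- y2) by exact: is_deriveN.
have j := lower_jet_derive dNy dNy'.
have key m' : m' < - y2 -> p - y1 x = 0 /\ (m + m') / 2 <= 0.
  move=> /j jm'; apply: (@quadratic_near_le0 _ _ _ x).
  near=> u.
  have h1 : y x + p * (u - x) + m / 2 * (u - x) ^+ 2 <= y u by near: u.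
  have h2 : - y x + (- y1 x) * (u - x) + m' / 2 * (u - x) ^+ 2 <= - y u.
    by near: u.
  have := lerD h1 h2; rewrite subrr; apply: le_trans.
  by rewrite le_eqVlt; apply/orP; left; apply/eqP; field.
have [|/eqP] := key (- y2 - 1); first by lra.
rewrite subr_eq0 => /eqP pE _; split => //.
rewrite leNgt; apply/negP => lt_m.
(* The midpoint of [- y2] and [- m]: it lies below [- y2] when [y2 < m], yet its sum with [m] is
   positive. *)
have [|_] := key (- (y2 + m) / 2); first by lra.
by lra.
Unshelve. all: by end_near. Qed.

(** * Self-similar quadratic test functions *)

Section quadratic_test_function.
Variables (R : realType) (a da : nat -> R -> R).
Hypothesis da_ex : forall i (s : R), 0 < s -> is_derive s 1 (a i) (da i s).
Hypothesis da_cont : forall i (s : R), 0 < s -> {for s, continuous (da i)}.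

Let psi (s y : R) : R := a 0 s + a 1 s * y + a 2 s * y ^+ 2.

Lemma derive1_quadratic_t (s y : R) : 0 < s ->
  is_derive s 1 (fun s => psi s y) (da 0 s + da 1 s * y + da 2 s * y ^+ 2).
Proof.
move=> s0; rewrite /psi.
have d0 := @da_ex 0 s s0; have d1 := @da_ex 1 s s0; have d2 := @da_ex 2 s s0.
by apply: is_derive_eq; rewrite /GRing.scale/=; ring.
Qed.

Lemma derive1_quadratic_x (s y : R) :
  is_derive y 1 (psi s) (a 1 s + 2 * a 2 s * y).
Proof. by rewrite /psi; apply: is_derive_eq; rewrite /GRing.scale/=; ring. Qed.

Let derive1_psi s : derive1 (psi s) = (fun y => a 1 s + 2 * a 2 s * y).
Proof.
by apply/funext => y; have d := derive1_quadratic_x s y; rewrite derive1E derive_val.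
Qed.

Lemma derive2_quadratic_x (s y : R) :
  is_derive y 1 (derive1 (psi s)) (2 * a 2 s).
Proof.
by rewrite derive1_psi; apply: is_derive_eq; rewrite /GRing.scale/=; ring.
Qed.

Lemma C12_quadratic : C12 psi.
Proof.
move=> t x t0.
have ca i : {for t, continuous (a i)}.
  apply: differentiable_continuous; apply/derivable1_diffP.
  by have d := @da_ex i t t0; exact: ex_derive.
have cfst (f : R -> R) : {for t, continuous f} ->
    {for (t, x), continuous (fun p : R * R => f p.1)}.
  move=> cf; apply: (@continuous_comp _ _ _ fst f); first exact: cvg_fst.
  exact: cf.
have csnd : {for (t, x), continuous (fun p : R * R => p.2)} by exact: cvg_snd.
have csnd2 : {for (t, x), continuous (fun p : R * R => p.2 ^+ 2)}.
  by apply: (@continuousM _ _ (fun p : R * R => p.2) (fun p : R * R => p.2)).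
have cquad (f : nat -> R -> R) : (forall i, {for t, continuous (f i)}) ->
    {for (t, x), continuous
      (fun p : R * R => f 0%N p.1 + f 1%N p.1 * p.2 + f 2 p.1 * p.2 ^+ 2)}.
  move=> cf; apply: (@continuousD _ _ _ (fun p : R * R => f 0%N p.1 + f 1%N p.1 * p.2)
    (fun p : R * R => f 2 p.1 * p.2 ^+ 2)).
    apply: (@continuousD _ _ _ (fun p : R * R => f 0%N p.1)
      (fun p : R * R => f 1%N p.1 * p.2)); first exact: cfst.
    by apply: continuousM => //; exact: cfst.
  by apply: continuousM => //; exact: cfst.
have d2 (s y : R) := derive2_quadratic_x s y.
split; split.
- by have d := derive1_quadratic_t x t0; exact: ex_derive.
- by have d := derive1_quadratic_x t x; exact: ex_derive.
- exact: ex_derive.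
- exact: cquad.
- have cda := cquad da (fun i => @da_cont i t t0).
  (* The coefficients have known derivatives only at positive times, so the formula is available
     near [(t, x)] and not everywhere. *)
  have dE : \forall p \near (t, x), (fun p : R * R =>
      da 0%N p.1 + da 1%N p.1 * p.2 + da 2 p.1 * p.2 ^+ 2) p =
      derive1 (fun s => psi s p.2) p.1.
    have : \forall p \near (t, x), (0:R) < p.1.
      have c1 : {for (t, x), continuous (fun p : R * R => p.1)} by exact: cvg_fst.
      by apply: (c1 [set s | 0 < s]); exact: lt_nbhsr.
    apply: filterS => p p0.
    by have d := derive1_quadratic_t p.2 p0; rewrite derive1E derive_val.
  rewrite /prop_for /continuous_at -(nbhs_singleton dE).
  by apply: cvg_trans cda; apply: near_eq_cvg.
- have -> : (fun p : R * R => derive1 (psi p.1) p.2) =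
      (fun p : R * R => a 1 p.1 + 2 * a 2 p.1 * p.2).
    by apply/funext => p; rewrite derive1_psi.
  apply: (@continuousD _ _ _ (fun p : R * R => a 1 p.1)
      (fun p : R * R => 2 * a 2 p.1 * p.2)); first exact: cfst.
  apply: continuousM => //; apply: (cfst (fun s => 2 * a 2 s)).
  by apply: continuousM; [exact: cst_continuous|exact: ca].
- have -> : (fun p : R * R => derive1n 2 (psi p.1) p.2) =
      (fun p : R * R => 2 * a 2 p.1).
    by apply/funext => p; rewrite /derive1n/= derive1E derive_val.
  apply: (cfst (fun s => 2 * a 2 s)).
  by apply: continuousM; [exact: cst_continuous|exact: ca].
Qed.

End quadratic_test_function.

(** Reduces the powers of [1 + s] below to the exponent [- lam] and divisions by a square root, a
    form that [field] handles. *)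
Lemma powRB_half (R : realType) (T q : R) : 0 < T ->
  T `^ (q - 1 / 2) = T `^ q / Num.sqrt T.
Proof.
move=> T0; rewrite powRB; last by rewrite (gt_eqF T0) implybT.
by rewrite div1r powR12_sqrt// ltW.
Qed.

(* The test function [(1 + s)^(-lam) * q (y / sqrt (1 + s))], where the quadratic
   polynomial [q] touches [H] from below at [xi]; at [(1, xi * sqrt 2)] its
   [d/dt - G (d^2/dx^2)] is a negative multiple of the left-hand side of the ODE. *)
Lemma supersolution_touching (R : realType) (sigma lam : R)
    (u : R -> R -> R) (H : R -> R) (xi p m : R) :
  G_heat_supersolution sigma u ->
  (forall t x : R, 0 <= t ->
     u t x = (1 + t) `^ (- lam) * H (x / Num.sqrt (1 + t))) ->
  (\forall y \near xi, H xi + p * (y - xi) + m / 2 * (y - xi) ^+ 2 <= H y) ->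
  2 * G sigma m + xi * p + 2 * lam * H xi <= 0.
Proof.
move=> super uE touch.
(* The [k i] are the coefficients of the touching polynomial in powers of [y / sqrt (1 + s)]; each
   factor [y] lowers the exponent of [1 + s] by one half. *)
pose q (i : nat) : R := - lam - i%:R / 2.
pose k (i : nat) : R := [:: H xi - p * xi + m / 2 * xi ^+ 2; p - m * xi; m / 2]`_i.
pose a i (s : R) : R := k i * (1 + s) `^ q i.
pose da i (s : R) : R := k i * (q i * (1 + s) `^ (q i - 1)).
have s1_gt0 (s : R) : 0 < s -> 0 < 1 + s by move=> s0; lra.
have dpow (r s : R) : 0 < s ->
    is_derive s 1 (fun s : R => (1 + s) `^ r) (r * (1 + s) `^ (r - 1)).
  move=> /s1_gt0 s0; rewrite -[X in is_derive _ _ _ X]mulr1.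
  have d1 : is_derive s 1 (fun s : R => 1 + s) 1.
    by apply: is_derive_eq; rewrite add0r mulr1.
  exact: (@is_derive1_comp _ (fun T => T `^ r) (fun s => 1 + s) _ _ _
    (is_derive1_powR r s0) d1).
have da_ex i (s : R) : 0 < s -> is_derive s 1 (a i) (da i s).
  move=> s0; have d := dpow (q i) s s0.
  by rewrite /a /da; apply: is_derive_eq; rewrite /GRing.scale/=; ring.
have da_cont i (s : R) : 0 < s -> {for s, continuous (da i)}.
  move=> s0; apply: differentiable_continuous; apply/derivable1_diffP.
  have d := dpow (q i - 1) s s0.
  by rewrite /da; exact: ex_derive.
pose psi (s y : R) : R := a 0%N s + a 1%N s * y + a 2 s * y ^+ 2.
have C12psi : C12 psi by exact: C12_quadratic da_ex da_cont.
have psiE (s y : R) : 0 < s -> psi s y = (1 + s) `^ (- lam) *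
    (let h := y / Num.sqrt (1 + s) - xi in H xi + p * h + m / 2 * h ^+ 2).
  move=> /s1_gt0 s0; rewrite /psi /a /q /k /=.
  have -> : - lam - 2 / 2 = - lam - 1 / 2 - 1 / 2 by field.
  rewrite mul0r subr0 !powRB_half//.
  by field; rewrite gt_eqF// sqrtr_gt0.
(* The inequality is tested at the positive time 1, at the abscissa [xi * S] whose rescaling is
   [xi]. *)
pose S : R := Num.sqrt (1 + 1); pose E : R := (1 + 1) `^ (- lam).
have S0 : 0 < S by rewrite sqrtr_gt0; lra.
have Sn0 : S != 0 by rewrite gt_eqF.
have S2 : S ^+ 2 = 1 + 1 by rewrite sqr_sqrtr//; lra.
have E0 : 0 < E by rewrite powR_gt0; lra.
have nbhs_xi : \forall z \near ((1 : R), xi * S),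
    H xi + p * (z.2 / Num.sqrt (1 + z.1) - xi) +
      m / 2 * (z.2 / Num.sqrt (1 + z.1) - xi) ^+ 2 <=
    H (z.2 / Num.sqrt (1 + z.1)).
  have cz : {for ((1 : R), xi * S),
      continuous (fun z : R * R => z.2 / Num.sqrt (1 + z.1))}.
    apply: continuousM; first exact: cvg_snd.
    apply: continuousV; first exact: Sn0.
    apply: (@continuous_comp _ _ _ (fun z : R * R => 1 + z.1) Num.sqrt).
      by apply: continuousD; [exact: cst_continuous|exact: cvg_fst].
    exact: sqrt_continuous.
  apply: (cz [set h | H xi + p * (h - xi) + m / 2 * (h - xi) ^+ 2 <= H h]).
  by rewrite /= -/S mulfK.
have touch_psi : \forall z \near ((1 : R), xi * S),
    u 1 (xi * S) - psi 1 (xi * S) <= u z.1 z.2 - psi z.1 z.2.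
  have z1_gt0 : \forall z \near ((1 : R), xi * S), (0 : R) < z.1.
    have c1 : {for ((1 : R), xi * S), continuous (fun z : R * R => z.1)}.
      exact: cvg_fst.
    by apply: (c1 [set s | 0 < s]); exact: lt_nbhsr.
  near=> z.
  have z0 : 0 < z.1 by near: z.
  rewrite !psiE// (uE z.1 _ (ltW z0)) (uE 1 _ ler01) /= -/S mulfK//.
  rewrite subrr mulr0 expr0n mulr0 !addr0 subrr.
  rewrite -mulrBr mulr_ge0 ?powR_ge0// subr_ge0.
  by near: z.
have := super psi C12psi 1 (xi * S) ltr01 touch_psi.
have dt := derive1_quadratic_t da_ex (xi * S) ltr01.
have dx := derive2_quadratic_x a 1 (xi * S).
rewrite {1}derive1E derive_val /derive1n/= derive1E derive_val.
have -> : 2 * a 2 1 = E / S ^+ 2 * m.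
  rewrite /a /q /k/=.
  have -> : - lam - 2 / 2 = - lam - 1 / 2 - 1 / 2 by field.
  by rewrite !powRB_half -/E -/S; [field|lra..].
rewrite GZ; last by rewrite divr_ge0 ?sqr_ge0 ?ltW.
(* All terms carry [E / S^2]. The sums of [k i * xi^i] and [i * k i * xi^i] are [H xi] and [xi * p],
   the value of the polynomial at [xi] and [xi] times its slope. *)
have -> : da 0%N 1 + da 1%N 1 * (xi * S) + da 2 1 * (xi * S) ^+ 2 =
    - (E / S ^+ 2) * (lam * H xi + xi * p / 2).
  rewrite /da /q /k/= mul0r subr0.
  have e1 : - lam - 1 = - lam - 1 / 2 - 1 / 2 by field.
  have e2 : - lam - 1 / 2 - 1 = - lam - 1 / 2 - 1 / 2 - 1 / 2 by field.
  have e3 : - lam - 2 / 2 - 1 = - lam - 1 / 2 - 1 / 2 - 1 / 2 - 1 / 2 by field.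
  rewrite e3 e2 e1 !powRB_half -/E -/S; [|lra..].
  by field.
have ES : 0 < E / S ^+ 2 by rewrite divr_gt0// exprn_gt0.
rewrite mulNr -opprD oppr_ge0 -mulrDr pmulr_rle0//.
by lra.
Unshelve. all: by end_near. Qed.

(** * Nonexistence for the ODE and for the [G]-heat equation *)

Theorem proposition4p5 (R : realType) (sigma : R)
    (sigma_gt0 : 0 < sigma) (sigma_lt1 : sigma < 1)
    (lambda_sigma : R)
    (lambda_sigma_gt0 : 0 < lambda_sigma) (lambda_sigma_lt : lambda_sigma < 1 / 2)
    (lambda_sigmaE : sigma_of lambda_sigma = sigma)
    (lam : R) (lam_gt : lambda_sigma < lam) (lam_lt : lam < 1 / 2) :
  (~ exists y : R -> R,
       [/\ forall x : R, 0 < y x,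
           C2 y
         & forall x : R,
             pos_part (derive1n 2 y x) - sigma ^+ 2 * neg_part (derive1n 2 y x)
             + x * derive1 y x + 2 * lam * y x = 0]) /\
  (~ exists (u : R -> R -> R) (H : R -> R),
       [/\ G_heat_solution sigma u,
           forall t x : R, 0 <= t -> 0 < u t x,
           forall x : R, u 0 x = H x
         & forall t x : R, 0 <= t ->
             u t x = (1 + t) `^ (- lam) * H (x / Num.sqrt (1 + t))]).
Proof.
split.
  move=> [y [y0 C2y ode]].
  have cy : continuous y.
    move=> x; apply: differentiable_continuous; apply/derivable1_diffP.
    by have [dy _ _] := C2y.
  have [x [p [m [touch ineq]]]] := positive_touching_jet sigma_gt0 sigma_lt1
    lambda_sigmaE lambda_sigma_gt0 lam_gt lam_lt cy y0.
  (* The contact makes [p] the slope of [y] and puts [m] below its second derivative; monotonicity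
     of [G] then makes the left-hand side of the ODE positive. *)
  have [pE le_m] := C2_quadratic_below C2y touch.
  have le_G := le_2G sigma_gt0 sigma_lt1 le_m.
  move: (ode x) ineq le_G; rewrite pE /G !mulrA divff ?pnatr_eq0// !mul1r.
  by move=> odex ineq le_G; lra.
move=> [u [H [[cu _ super] u0 uH uE]]].
have H0 x : 0 < H x by rewrite -uH u0.
(* [H] is the trace of [u] at time 0, where [u] is continuous within the closed half-plane; the map
   sending [y] to [(0, y)] stays in that half-plane. *)
have cH : continuous H.
  move=> x; have -> : H = (fun y => u 0 y) by apply/funext => y; rewrite uH.
  have /subspace_continuousP/(_ (0, x) (lexx 0)) cux := cu.
  apply: (cvg_comp (fun y : R => (0 : R, y)) (fun z => u z.1 z.2) _ cux).
  have c0 : (0 : R, y) @[y --> x] --> ((0 : R), x).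
    have c0 : {for x, continuous (cst (0 : R))} by exact: cst_continuous.
    have c1 : {for x, continuous (fun y : R => y)} by [].
    by have := cvg_pair c0 c1; apply.
  move=> V /c0 Vx; change (\forall y \near x, V (0, y)).
  near=> y; have : [set z : R * R | 0 <= z.1] (0, y) -> V (0, y) by near: y.
  by apply => /=.
have [x [p [m [touch ineq]]]] := positive_touching_jet sigma_gt0 sigma_lt1
  lambda_sigmaE lambda_sigma_gt0 lam_gt lam_lt cH H0.
have := supersolution_touching super uE touch.
by rewrite leNgt ineq.
Unshelve. all: by end_near. Qed.
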